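(* Let $k\ge2$ and let $z_0\in\mathbb{C}\setminus\mathbb{R}$ be a non-real singular point of $P_{\varepsilon^*}(z)\frac{\partial}{\partial z}\in\mathcal{P}_{\mathbb{R},k+1}$ for a particular value $\varepsilon^*\in\mathbb{R}^k$ of $\varepsilon$. Then a full unfolding of $z_0$ exists in the family $\mathcal{P}_{\mathbb{R},k+1}$.
   Context: $\mathcal{P}_{\mathbb{R},k+1}$ is the family of vector fields $P_\varepsilon(z)\frac{\partial}{\partial z}$ on $\mathbb{C}$ with $P_\varepsilon(z)=z^{k+1}+\varepsilon_{k-1}z^{k-1}+\dots+\varepsilon_1z+\varepsilon_0$, $\varepsilon=(\varepsilon_{k-1},\dots,\varepsilon_0)\in\mathbb{R}^k$. Singular points are the zeros of $P_\varepsilon$. Let $s\ge1$ be the multiplicity of $z_0$ as a zero of $P_{\varepsilon^*}$. For $\varepsilon$ near $\varepsilon^*$, exactly $s$ zeros of $P_\varepsilon$ (counted with multiplicity) lie near $z_0$; let $W_\varepsilon$ be the monic polynomial of degree $s$ whose zeros are these (the Weierstrass polynomial of $P_\varepsilon$ at $z_0$), so $W_{\varepsilon^*}(z)=(z-z_0)^s$. Let $b(\varepsilon)$ be the mean of the zeros of $W_\varepsilon$, and write $W_\varepsilon(b(\varepsilon)+w)=w^s+a_{s-2}(\varepsilon)w^{s-2}+\dots+a_1(\varepsilon)w+a_0(\varepsilon)$. The family $\mathcal{P}_{\mathbb{R},k+1}$ contains a full (or complete) unfolding of $z_0$ if the real-analytic map $\varepsilon\mapsto(a_{s-2}(\varepsilon),\dots,a_0(\varepsilon))\in\mathbb{C}^{s-1}\cong\mathbb{R}^{2(s-1)}$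 is a submersion at $\varepsilon=\varepsilon^*$, i.e. up to translation in $z$, the zeros merging at $z_0$ are deformed in all possible ways inside the family (for $s=1$ the condition is empty). *)

(* Defs.v *)
From HB Require Import structures.
From mathcomp Require Import all_boot all_order all_algebra.
From mathcomp Require Import all_classical all_reals all_analysis.
From mathcomp Require Export complex.

Set Implicit Arguments.
Unset Strict Implicit.
Unset Printing Implicit Defensive.

Import Order.TTheory GRing.Theory Num.Theory.
Import numFieldNormedType.Exports.

Local Open Scope classical_set_scope.
Local Open Scope complex_scope.
Local Open Scope ring_scope.

(* The parameter eps_j of the family is the coordinate [eps 0 j]. *)
Definition P_fam (R : realType) (k : nat) (eps : 'rV[R]_k) : {poly R[i]} :=
  'X^(k.+1) + \sum_(j < k) (eps 0 j)%:C *: 'X^j.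

(* Zeros listed with multiplicity (the list is meaningful only for p != 0). *)
Definition zeros (R : realType) (p : {poly R[i]}) : seq R[i] :=
  sval (closed_field_poly_normal p).

Definition zeros_near (R : realType) (p : {poly R[i]}) (z0 : R[i]) (r : R) :
    seq R[i] :=
  [seq z <- zeros p | `|z - z0| < r%:C].

Definition weierstrass_poly (R : realType) (p : {poly R[i]}) (z0 : R[i])
    (r : R) : {poly R[i]} :=
  \prod_(z <- zeros_near p z0 r) ('X - z%:P).

Definition mean (R : realType) (zs : seq R[i]) : R[i] :=
  (\sum_(z <- zs) z) / (size zs)%:R.

(* W(b + w) as a polynomial in w, where b is the mean of the zeros of W. *)
Definition centered_weierstrass_poly (R : realType) (p : {poly R[i]})
    (z0 : R[i]) (r : R) : {poly R[i]} :=
  weierstrass_poly p z0 r \Po ('X + (mean (zeros_near p z0 r))%:P).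

(* eps |-> (a_j(eps))_(j < s - 1), with C^(s-1) identified with R^(2(s-1)) by
   listing the real parts first and then the imaginary parts. *)
Definition unfolding_map (R : realType) (k s : nat) (z0 : R[i]) (r : R)
    (eps : 'rV[R]_k) : 'rV[R]_(s.-1 + s.-1) :=
  let a := centered_weierstrass_poly (P_fam eps) z0 r in
  row_mx (\row_(j < s.-1) complex.Re a`_j) (\row_(j < s.-1) complex.Im a`_j).

Definition submersion_at (R : realType) (V W : normedModType R) (f : V -> W)
    (x : V) : Prop :=
  differentiable f x /\ set_surj setT setT ('d f x).

(* "Zeros near z0" means zeros at distance less than r, for every sufficiently
   small r > 0.  Two small radii select the same zeros once eps is close enough
   to eps_star, so the germ of the map at eps_star does not depend on r. *)
Definition full_unfolding (R : realType) (k : nat) (eps_star : 'rV[R]_k)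
    (z0 : R[i]) : Prop :=
  \forall r \near 0^'+,
    submersion_at (unfolding_map (mup z0 (P_fam eps_star)) z0 r) eps_star.

(* Main.v *)
Require Import Defs.
From HB Require Import structures.
From mathcomp Require Import all_boot all_order all_algebra.
From mathcomp Require Import all_classical all_reals all_analysis.
From mathcomp Require Import ring.
Import GRing.Theory Num.Theory.
Local Open Scope ring_scope.

(* Write [P = P_(eps_star)] and let [s] be the multiplicity of [z0].  Moving
   [z0] to [0], [P = X^s Q] with [Q] invertible modulo [X^s].  By continuity of
   roots [P_eps = W_eps Q_eps] with [W_eps] the Weierstrass polynomial and
   [Q_eps --> Q]; subtracting, [(W_eps - X^s) Q_eps = P_eps - P] modulo [X^s],
   whence [W_eps - X^s = Q^-1 (P_eps - P) + o(eps - eps_star)] modulo [X^s]: only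
   continuity of the factors is needed for differentiability at [eps_star].
   Centering [W_eps] changes its coefficients of degree [< s - 1] to second order
   only.  So the derivative sends the real polynomial [H] of degree [< k] to the
   coefficients of degree [< s - 1] of [Q^-1 H] at [z0].

   For surjectivity, since [z0] is not real, [(X - z0)^s] and its conjugate are
   coprime and both divide the real polynomial [P], so [2 s <= k + 1], and the
   Chinese remainder theorem provides a real [H] of degree [< 2 s], hence [<= k],
   with any prescribed residue modulo [(X - z0)^s].  Its coefficient of degree [k]
   is removed by subtracting a multiple of [P'], which only affects the
   coefficient of degree [s - 1] of [Q^-1 H]. *)

Set Implicit Arguments.
Unset Strict Implicit.
Unset Printing Implicit Defensive.
Import Order.TTheory numFieldNormedType.Exports.
Local Open Scope classical_set_scope.

(** * Convergence of polynomials and of their roots *)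

Section PolyCvg.
Variables (C : numFieldType) (T : Type) (F : set_system T).
Context {FF : Filter F}.

(** Convergence is coefficientwise, with no bound on the degrees; evaluation and division therefore
    ask for a uniform size bound separately. *)
Definition poly_cvg (p : T -> {poly C}) (l : {poly C}) :=
  forall j, (p t)`_j @[t --> F] --> l`_j.

Lemma cvg_bigsum (I : Type) (r : seq I) (P : pred I) (f : I -> T -> C)
    (a : I -> C) :
  (forall i, P i -> f i t @[t --> F] --> a i) ->
  \sum_(i <- r | P i) f i t @[t --> F] --> \sum_(i <- r | P i) a i.
Proof. by apply: cvg_big; exact: add_continuous. Qed.

Lemma poly_cvg_cst p : poly_cvg (fun=> p) p.
Proof. by move=> j; exact: cvg_cst. Qed.

Lemma poly_cvgM p q a b :
  poly_cvg p a -> poly_cvg q b -> poly_cvg (fun t => p t * q t) (a * b).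
Proof.
move=> pa qb j; rewrite coefM; under eq_cvg do rewrite coefM.
by apply: cvg_bigsum => i _; exact: cvgM (pa _) (qb _).
Qed.

Lemma poly_cvgXsubC (f : T -> C) (a : C) :
  f t @[t --> F] --> a -> poly_cvg (fun t => 'X - (f t)%:P) ('X - a%:P).
Proof.
move=> fa j; rewrite coefB coefC; under eq_cvg do rewrite coefB coefC.
by apply: cvgB; [exact: cvg_cst | case: eqP => _; [exact: fa | exact: cvg_cst]].
Qed.

Lemma poly_cvg_prod n (f : T -> nat -> C) (a : nat -> C) m :
  (forall i, f t i @[t --> F] --> a i) ->
  poly_cvg (fun t => \prod_(m <= i < n) ('X - (f t i)%:P))
           (\prod_(m <= i < n) ('X - (a i)%:P)).
Proof.
have base j : (j <= m)%N -> poly_cvg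
    (fun t => \prod_(m <= i < j) ('X - (f t i)%:P))
    (\prod_(m <= i < j) ('X - (a i)%:P)).
  move=> jm; rewrite big_geq // (_ : (fun _ => _) = fun=> 1); last first.
    by apply/funext => t; rewrite big_geq.
  exact: poly_cvg_cst.
move=> fa; elim: n => [|n IH]; first exact: base.
have [mn|nm] := leqP m n; last exact: base.
rewrite big_nat_recr //= (_ : (fun _ => _) =
    fun t => \prod_(m <= i < n) ('X - (f t i)%:P) * ('X - (f t n)%:P)).
  by apply: poly_cvgM IH _; exact: poly_cvgXsubC.
by apply/funext => t; rewrite big_nat_recr.
Qed.

Lemma horner_cvg n (p : T -> {poly C}) (l : {poly C}) (a : C) :
  (forall t, size (p t) <= n)%N -> (size l <= n)%N ->
  poly_cvg p l -> (p t).[a] @[t --> F] --> l.[a].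
Proof.
move=> sp sl pl; rewrite (horner_coef_wide _ sl).
under eq_cvg do rewrite (horner_coef_wide _ (sp _)).
by apply: cvg_bigsum => i _; apply: cvgM (pl i) _; exact: cvg_cst.
Qed.

(* Synthetic division: the coefficients of the quotient by ['X - w] are
   recovered from the top down. *)
Lemma poly_cvg_divXsubC n (q : T -> {poly C}) (w : T -> C) (p : {poly C})
    (a : C) :
  (forall t, size (q t) <= n)%N -> (size p <= n)%N -> w t @[t --> F] --> a ->
  poly_cvg (fun t => ('X - (w t)%:P) * q t) (('X - a%:P) * p) -> poly_cvg q p.
Proof.
move=> sq sp wa H.
suff G m : forall j, (n <= j + m)%N -> (q t)`_j @[t --> F] --> p`_j.
  by move=> j; apply: (G n); exact: leq_addl.
elim: m => [|m IH] j.
  rewrite addn0 => nj; rewrite nth_default ?(leq_trans sp) //.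
  under eq_cvg do rewrite nth_default ?(leq_trans (sq _)) //.
  exact: cvg_cst.
rewrite addnS -addSn => /IH Hj.
have E (u : C) (f : {poly C}) : f`_j = (('X - u%:P) * f)`_j.+1 + u * f`_j.+1.
  by rewrite mulrBl coefB coefXM coefCM subrK.
rewrite (E a p); under eq_cvg => t do rewrite (E (w t) (q t)).
by apply: cvgD (H _) _; exact: cvgM.
Qed.

Lemma poly_cvg_exp (p : T -> {poly C}) (l : {poly C}) n :
  poly_cvg p l -> poly_cvg (fun t => p t ^+ n) (l ^+ n).
Proof.
move=> pl; elim: n => [|n IH]; first exact: poly_cvg_cst.
rewrite exprS (_ : (fun _ => _) = fun t => p t * p t ^+ n).
  exact: poly_cvgM.
by apply/funext => t; rewrite exprS.
Qed.

Lemma poly_cvgXaddC0 (b : T -> C) :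
  b t @[t --> F] --> (0 : C) -> poly_cvg (fun t => 'X + (b t)%:P) 'X.
Proof.
move=> b0 i; rewrite -[X in _ --> X]addr0; under eq_cvg do rewrite coefD coefC.
by apply: cvgD; [exact: cvg_cst | case: eqP => _ //; exact: cvg_cst].
Qed.

End PolyCvg.

(** * Labelling the roots of a convergent family of polynomials *)

Section RootCvg.
Variables (C : numClosedFieldType) (T : Type) (F : set_system T).
Context {FF : Filter F}.

(** The distances from [a] cannot all exceed their geometric mean: with [c] the norm of the product
    and [n] the size, multiplying [c < |a - w|^n] over all [w] would give [c^n < c^n]. A small value
    of a monic polynomial at [a] thus forces a root near [a]. *)
Lemma prod_norm_ge_min (s : seq C) (a : C) : (0 < size s)%N ->
  exists2 w, w \in s & `|a - w| ^+ size s <= `|\prod_(x <- s) (a - x)|.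
Proof.
move=> s0; have [//|H] := pselect (exists2 w, w \in s &
  `|a - w| ^+ size s <= `|\prod_(x <- s) (a - x)|).
have {}H w : w \in s -> `|\prod_(x <- s) (a - x)| < `|a - w| ^+ size s.
  move=> ws; rewrite real_ltNge ?rpredX ?normr_real //.
  by apply/negP => Hw; apply: H; exists w.
have [/hasP[w ws /eqP wa]|/hasPn aN] := boolP (has (fun w => w == a) s).
  by move: (H w ws); rewrite wa subrr normr0 expr0n eqn0Ngt s0 /= normr_lt0.
have P0 : 0 < `|\prod_(x <- s) (a - x)|.
  rewrite normr_gt0 prodf_seq_neq0; apply/allP => x xs /=.
  by rewrite subr_eq0 eq_sym; exact: aN.
suff : `|\prod_(x <- s) (a - x)| ^+ size s < `|\prod_(x <- s) (a - x)| ^+ size s.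
  by rewrite ltxx.
rewrite [X in _ < X](_ : _ = \prod_(x <- s) `|a - x| ^+ size s); last first.
  by rewrite normr_prod prodrXl.
rewrite -[X in X < _](_ : \prod_(x <- s) `|\prod_(x <- s) (a - x)| = _); last first.
  by rewrite big_const_seq count_predT -Monoid.iteropE /=.
have : {in s, forall x, `|\prod_(x <- s) (a - x)| < `|a - x| ^+ size s} by [].
have {H aN} : s != [::] by rewrite -size_eq0 -lt0n.
(* The product and the exponent are frozen as [c] and [n], so that the induction on [s] leaves them
   unchanged. *)
move: (\prod_(x <- s) (a - x)) P0 => c c0; move: (size s) => n.
case: s s0 => // x s _ _.
elim: s x => [|y s IH] x Hx.
  by rewrite !big_seq1; apply: Hx; rewrite inE.
rewrite big_cons [X in _ < X]big_cons; apply: ltr_pM => //.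
- by rewrite prodr_ge0.
- by apply: Hx; rewrite mem_head.
- by apply: IH => z zs; apply: Hx; rewrite inE zs orbT.
Qed.

(** Since the value at the first limit root [a] tends to [0], a root [w t] with [|a - w t|^(n+1)]
    below that value tends to [a]. Dividing by [X - w t] leaves a convergent quotient with one root
    fewer, and the induction goes on. *)
Lemma roots_cvg n (q : T -> seq C) (l : seq C) :
  (forall t, size (q t) = n) -> size l = n ->
  poly_cvg F (fun t => \prod_(z <- q t) ('X - z%:P)) (\prod_(z <- l) ('X - z%:P)) ->
  exists s : T -> seq C, (forall t, perm_eq (s t) (q t)) /\
    forall i, (s t)`_i @[t --> F] --> l`_i.
Proof.
elim: n q l => [|n IH] q [|a l] // sq sl H.
  exists q; split=> // i; rewrite nth_nil.
  under eq_cvg do rewrite nth_default ?sq //.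
  exact: cvg_cst.
have qw t : exists w, w \in q t /\
    `|a - w| ^+ n.+1 <= `|\prod_(x <- q t) (a - x)|.
  have [|w wq] := @prod_norm_ge_min (q t) a; first by rewrite sq.
  by rewrite sq; exists w.
have [w {}qw] := choice qw.
have wa : w t @[t --> F] --> a.
  have h0 : (\prod_(z <- q t) ('X - z%:P)).[a] @[t --> F] --> (0 : C).
    have -> : (0 : C) = (\prod_(z <- a :: l) ('X - z%:P)).[a].
      by apply/esym/eqP; rewrite -/(root _ _) root_prod_XsubC mem_head.
    apply: (@horner_cvg _ _ _ _ n.+2) H => [t|].
      by rewrite size_prod_XsubC sq.
    by rewrite size_prod_XsubC sl.
  apply/cvgrPdist_lt => e e0.
  have /cvgr0Pnorm_lt /(_ (e ^+ n.+1)) := h0; rewrite exprn_gt0 // => /(_ isT).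
  apply: filterS => t; rewrite horner_prod => Ht.
  rewrite -(@ltr_pXn2r _ n.+1) ?nnegrE ?(ltW e0) //.
  have [_ /le_lt_trans] := qw t; apply; apply: le_lt_trans Ht.
  by under [X in _ <= `|X|]eq_bigr do rewrite hornerXsubC.
have pq t : perm_eq (q t) (w t :: rem (w t) (q t)).
  by apply: perm_to_rem; have [] := qw t.
have srem t : size (rem (w t) (q t)) = n.
  by have /perm_size := pq t; rewrite sq => -[].
have [|||s [ps Hs]] := IH (fun t => rem (w t) (q t)) l.
- exact: srem.
- by case: sl.
- apply: (@poly_cvg_divXsubC _ _ _ _ n.+1 _ w _ a) => //.
  + by move=> t; rewrite size_prod_XsubC srem.
  + by case: sl => sl; rewrite size_prod_XsubC sl.
  + move: H; rewrite big_cons (_ : (fun t => \prod_(z <- q t) _) =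
      fun t => ('X - (w t)%:P) * \prod_(z <- rem (w t) (q t)) ('X - z%:P)) //.
    by apply/funext => t; rewrite (perm_big _ (pq t)) big_cons.
- exists (fun t => w t :: s t); split=> [t|[|i]] /=; [|exact: wa|exact: Hs].
  by rewrite perm_sym (permPl (pq t)) perm_cons perm_sym.
Qed.

End RootCvg.

(** * Asymptotics of a factor *)

Section Asymptotics.
Variables (C : numFieldType) (T : Type) (F : set_system T).
Context {FF : Filter F}.
Variable rho : T -> C.
Hypothesis rho_ge0 : forall t, 0 <= rho t.
Implicit Types f g : T -> C.

(** The gauge [rho] will be the distance [|t - eps0|] embedded in the complex numbers; there [0 < M]
    already forces [M] to be real. *)
Definition is_bigO f :=
  exists2 M : C, 0 < M & \forall t \near F, `|f t| <= M * rho t.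

Definition is_littleo f :=
  forall e : C, 0 < e -> \forall t \near F, `|f t| <= e * rho t.

Lemma littleoW f : is_littleo f -> is_bigO f.
Proof. by move=> /(_ 1 ltr01) Hf; exists 1. Qed.

Lemma bigO_near f g : (\forall t \near F, f t = g t) -> is_bigO f -> is_bigO g.
Proof.
move=> fg [M M0 Mf]; exists M => //; move: fg; apply: filter_app.
by move: Mf; apply: filterS => t + <-.
Qed.

Lemma littleo0 : is_littleo (fun=> 0).
Proof. by move=> e e0; apply: nearW => t; rewrite normr0 mulr_ge0 // ltW. Qed.

Lemma littleoD f g : is_littleo f -> is_littleo g ->
  is_littleo (fun t => f t + g t).
Proof.
move=> fo go e e0; have e2 : 0 < e / 2 by rewrite divr_gt0.
move: (fo _ e2) (go _ e2); apply: filterS2 => t ft gt.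
by rewrite (le_trans (ler_normD _ _)) // [e]splitr mulrDl lerD.
Qed.

Lemma bigOD f g : is_bigO f -> is_bigO g -> is_bigO (fun t => f t + g t).
Proof.
move=> [M M0 Mf] [N N0 Ng]; exists (M + N); first exact: addr_gt0.
move: Mf Ng; apply: filterS2 => t ft gt.
by rewrite (le_trans (ler_normD _ _)) // mulrDl lerD.
Qed.

Lemma littleo_sum (I : Type) (r : seq I) (P : pred I) (f : I -> T -> C) :
  (forall i, P i -> is_littleo (f i)) ->
  is_littleo (fun t => \sum_(i <- r | P i) f i t).
Proof.
move=> fo; rewrite (_ : (fun _ => _) =
    \big[(fun f g t => f t + g t)/fun=> 0]_(i <- r | P i) f i).
  by elim/big_ind : _ => //; [exact: littleo0 | exact: littleoD].
by apply/funext => t; elim/big_rec2 : _ => // i y z _ ->.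
Qed.

Lemma bigO_sum (I : Type) (r : seq I) (P : pred I) (f : I -> T -> C) :
  (forall i, P i -> is_bigO (f i)) ->
  is_bigO (fun t => \sum_(i <- r | P i) f i t).
Proof.
move=> fo; rewrite (_ : (fun _ => _) =
    \big[(fun f g t => f t + g t)/fun=> 0]_(i <- r | P i) f i).
  elim/big_ind : _ => //; [exact/littleoW/littleo0 | exact: bigOD].
by apply/funext => t; elim/big_rec2 : _ => // i y z _ ->.
Qed.

Lemma cvgM_bigO g f (a : C) : g t @[t --> F] --> a -> is_bigO f ->
  is_bigO (fun t => g t * f t).
Proof.
move=> ga [M M0 Mf]; exists ((`|a| + 1) * M).
  by rewrite mulr_gt0 // ltr_wpDl.
have : \forall t \near F, `|g t| < `|a| + 1.
  by apply: (cvgr_norm_lt _ ga); rewrite ltrDl.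
move: Mf; apply: filterS2 => t ft gt.
by rewrite normrM -mulrA ler_pM // ltW.
Qed.

Lemma cvg0M_littleo g f : g t @[t --> F] --> (0 : C) -> is_bigO f ->
  is_littleo (fun t => g t * f t).
Proof.
move=> g0 [M M0 Mf] e e0; have eM : 0 < e / M by rewrite divr_gt0.
have : \forall t \near F, `|g t| < e / M by exact: (@cvgr0_norm_lt _ _ _ _ _ _ g0 _ eM).
move: Mf; apply: filterS2 => t ft gt.
rewrite normrM (le_trans (ler_pM _ _ (ltW gt) ft)) //.
by rewrite mulrA divfK // gt_eqF.
Qed.

Lemma littleoN f : is_littleo f -> is_littleo (fun t => - f t).
Proof. by move=> fo e /fo; apply: filterS => t; rewrite normrN. Qed.

(* Comparing coefficients of [D * Q] modulo ['X^s] and multiplying by the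
   inverse [v] of the limit of [Q] gives a triangular system for those of [D]. *)
Lemma truncated_quotient_expansion s (D Q E : T -> {poly C}) (Q0 v : {poly C}) :
  poly_cvg F Q Q0 ->
  (forall j, (j < s)%N -> (v * Q0)`_j = (j == 0)%:R) ->
  (forall t j, (j < s)%N -> (D t * Q t)`_j = (E t)`_j) ->
  (forall j, is_bigO (fun t => (E t)`_j)) ->
  forall j, (j < s)%N ->
    is_bigO (fun t => (D t)`_j) /\
    is_littleo (fun t => (D t)`_j - (v * E t)`_j).
Proof.
move=> QQ0 vQ DQ EO; elim/ltn_ind => j IH js.
have vcvg : poly_cvg F (fun t => v * Q t) (v * Q0).
  by apply: poly_cvgM => //; exact: poly_cvg_cst.
(* The off-diagonal part of the triangular system: its first factors tend to [0] because [v * Q0] is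
   [1] modulo [X^s], and its second factors are bounded by induction. *)
pose S t := \sum_(i < j) (v * Q t)`_i.+1 * (D t)`_(j - i.+1).
have So : is_littleo S.
  apply: littleo_sum => i _; apply: cvg0M_littleo.
    have := vcvg i.+1; rewrite vQ //.
    by exact: leq_ltn_trans (ltn_ord i) js.
  have ji : (j - i.+1 < j)%N by rewrite ltn_subrL /= (leq_ltn_trans _ (ltn_ord i)).
  by have [] := IH _ ji (ltn_trans ji js).
have vE t : (v * E t)`_j = (v * Q t)`_0 * (D t)`_j + S t.
  transitivity (((v * Q t) * D t)`_j).
    rewrite -mulrA !coefM; apply: eq_bigr => i _; rewrite [Q t * _]mulrC DQ //.
    exact: leq_ltn_trans (leq_subr _ _) js.
  by rewrite coefM big_ord_recl subn0.
have vEO : is_bigO (fun t => (v * E t)`_j).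
  rewrite (_ : (fun _ => _) = fun t => \sum_(i < j.+1) v`_i * (E t)`_(j - i)).
    by apply: bigO_sum => i _; apply: cvgM_bigO (EO _); exact: cvg_cst.
  by apply/funext => t; rewrite coefM.
have v1 : (v * Q t)`_0 @[t --> F] --> (1 : C).
  by have := vcvg 0; rewrite vQ //; exact: leq_ltn_trans js.
(* The diagonal entry tends to [1], so it can be inverted near the limit and the system solved for
   this coefficient. *)
have DO : is_bigO (fun t => (D t)`_j).
  apply: (@bigO_near (fun t => ((v * Q t)`_0)^-1 * ((v * E t)`_j + - S t))).
    have : \forall t \near F, (v * Q t)`_0 != 0.
      by apply: (cvgr_neq0 _ v1); rewrite oner_eq0.
    by apply: filterS => t v0; rewrite vE addrK mulKf.
  apply: (@cvgM_bigO _ _ (1^-1)).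
    by apply: cvgV => //; rewrite oner_eq0.
  by apply: bigOD => //; apply/littleoW/littleoN.
split=> //.
rewrite (_ : (fun _ => _) = fun t => - (((v * Q t)`_0 - 1) * (D t)`_j + S t)).
  apply/littleoN/littleoD => //; apply: cvg0M_littleo => //.
  rewrite -[X in _ --> X](subrr (1 : C)); apply: cvgB; [exact: v1|exact: cvg_cst].
by apply/funext => t; rewrite vE; ring.
Qed.

Lemma coef_expXaddC_bigO (b : T -> C) n j :
  b t @[t --> F] --> (0 : C) -> is_bigO b -> (j < n)%N ->
  is_bigO (fun t => (('X + (b t)%:P) ^+ n)`_j).
Proof.
move=> b0 bO; elim: n j => // n IH j jn.
rewrite (_ : (fun _ => _) = fun t =>
    (* The test is needed because [0.-1] is [0], which would select the constant coefficient. *)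
    (if j == 0%N then 0 else (('X + (b t)%:P) ^+ n)`_j.-1)
    + (('X + (b t)%:P) ^+ n)`_j * b t).
  apply: bigOD.
    case: j jn => [|j] jn /=; first exact/littleoW/littleo0.
    exact: IH.
  apply: (@cvgM_bigO _ _ ('X^n)`_j) => //.
  have H : poly_cvg F (fun t => ('X + (b t)%:P) ^+ n) 'X^n.
    by apply: poly_cvg_exp; exact: poly_cvgXaddC0.
  exact: (H j).
by apply/funext => t; rewrite exprS mulrDl coefD coefXM coefCM [b t * _]mulrC.
Qed.

(** Below degree [n - 1] every coefficient of [(X + b)^n] contains [b^2]: one factor [b] is of order
    [rho], the other tends to [0]. *)
Lemma coef_expXaddC_littleo (b : T -> C) n j :
  b t @[t --> F] --> (0 : C) -> is_bigO b -> (j.+1 < n)%N ->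
  is_littleo (fun t => (('X + (b t)%:P) ^+ n)`_j).
Proof.
move=> b0 bO; elim: n j => // n IH j jn.
rewrite (_ : (fun _ => _) = fun t =>
    (if j == 0%N then 0 else (('X + (b t)%:P) ^+ n)`_j.-1)
    + b t * (('X + (b t)%:P) ^+ n)`_j).
  apply: littleoD.
    by case: j jn => [|j] jn /=; [exact: littleo0 | exact: IH].
  by apply: cvg0M_littleo => //; exact: coef_expXaddC_bigO.
by apply/funext => t; rewrite exprS mulrDl coefD coefXM coefCM.
Qed.

(** The translate of [X^s] contributes only multiples of [b^2] in these degrees, and translating
    [X^i] changes its coefficients by quantities tending to [0], which multiply the bounded-order
    coefficients of [D]. *)
Lemma centered_coef_expansion s (D : T -> {poly C}) (b : T -> C) j :
  (forall t, size (D t) <= s)%N ->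
  (forall i, (i < s)%N -> is_bigO (fun t => (D t)`_i)) ->
  b t @[t --> F] --> (0 : C) -> is_bigO b -> (j.+1 < s)%N ->
  is_littleo (fun t => (('X^s + D t) \Po ('X + (b t)%:P))`_j - (D t)`_j).
Proof.
move=> sD DO b0 bO js.
have bX : poly_cvg F (fun t => 'X + (b t)%:P) 'X by exact: poly_cvgXaddC0.
rewrite (_ : (fun _ => _) = fun t => (('X + (b t)%:P) ^+ s)`_j
  + \sum_(i < s) ((('X + (b t)%:P) ^+ i)`_j - ('X^i)`_j) * (D t)`_i).
  apply: littleoD; first exact: coef_expXaddC_littleo.
  apply: littleo_sum => i _; apply: cvg0M_littleo; last exact: DO.
  rewrite -[X in _ --> X](subrr (('X^i)`_j : C)); apply: cvgB; last exact: cvg_cst.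
  have H : poly_cvg F (fun t => ('X + (b t)%:P) ^+ i) 'X^i by exact: poly_cvg_exp.
  exact: (H j).
apply/funext => t; rewrite comp_polyD coefD comp_Xn_poly -addrA; congr (_ + _).
have Ds : D t = \sum_(i < s) (D t)`_i *: 'X^i.
  by rewrite -poly_def; apply/polyP => i; rewrite coef_poly; case: ltnP => // si;
     rewrite nth_default // (leq_trans (sD t)).
under eq_bigr do rewrite mulrBl; rewrite sumrB; congr (_ - _).
  rewrite {1}Ds raddf_sum /= coef_sum; apply: eq_bigr => i _.
  by rewrite comp_polyZ comp_Xn_poly coefZ mulrC.
by rewrite {1}Ds coef_sum; apply: eq_bigr => i _; rewrite coefZ mulrC.
Qed.

End Asymptotics.

(** * Real interpolation at a non-real point *)

Section RealInterpolation.
Variable R : realType.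
Local Open Scope complex_scope.

Definition real_fam k (eps : 'rV[R]_k) : {poly R} :=
  'X^(k.+1) + \sum_(j < k) eps 0 j *: 'X^j.

Lemma P_famE k (eps : 'rV[R]_k) :
  P_fam eps = map_poly (real_complex R) (real_fam eps).
Proof.
rewrite rmorphD /= map_polyXn rmorph_sum; congr (_ + _).
by apply: eq_bigr => j _; rewrite /= map_polyZ /= map_polyXn.
Qed.

Lemma size_real_lower k (h : 'rV[R]_k) : (size (\sum_(j < k) h 0 j *: 'X^j)%R <= k)%N.
Proof.
apply: (leq_trans (size_sum _ _ _)); apply/bigmax_leqP => j _.
by rewrite (leq_trans (size_scale_leq _ _)) // size_polyXn.
Qed.

Lemma size_real_fam k (eps : 'rV[R]_k) : size (real_fam eps) = k.+2.
Proof.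
by rewrite /real_fam size_polyDl size_polyXn // ltnS (leq_trans (size_real_lower _)).
Qed.

Lemma monic_real_fam k (eps : 'rV[R]_k) : real_fam eps \is monic.
Proof.
rewrite monicE lead_coefDl ?lead_coefXn // size_polyXn ltnS.
by rewrite (leq_trans (size_real_lower _)).
Qed.

Lemma map_conjc_real (p : {poly R}) :
  map_poly conjc (map_poly (real_complex R) p) = map_poly (real_complex R) p.
Proof. by apply/polyP => j; rewrite !coef_map /= oppr0. Qed.

Lemma coprime_conj (z : R[i]) s : z \isn't Num.real ->
  coprimep (('X - z%:P) ^+ s) (('X - (conjc z)%:P) ^+ s).
Proof.
move=> zN; apply/coprimep_expl/coprimep_expr.
rewrite coprimep_XsubC root_XsubC; apply: contra zN.
case: z => a b; rewrite complex_real eq_complex /= eqxx /=.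
by rewrite eqNr.
Qed.

Lemma map_conjc_XsubC_exp (z : R[i]) s :
  map_poly conjc (('X - z%:P) ^+ s) = ('X - (conjc z)%:P) ^+ s.
Proof. by rewrite rmorphXn /= map_polyXsubC. Qed.

(* If [E] is [G] modulo [A = (X - z)^s] and [0] modulo its conjugate, then
   [E + conj E] is real and still equal to [G] modulo [A]. *)
Lemma real_interpolation (z : R[i]) s (G : {poly R[i]}) : z \isn't Num.real ->
  exists2 H : {poly R}, (size H <= s + s)%N &
    ('X - z%:P) ^+ s %| map_poly (real_complex R) H - G.
Proof.
move=> zN; set A := _ ^+ s; pose B := ('X - (conjc z)%:P) ^+ s.
have cAB : coprimep A B by exact: coprime_conj.
have [[u v] /= uv] := Bezout_eq1_coprimepP _ _ cAB.
have [A0 B0] : A != 0 /\ B != 0 by rewrite !expf_neq0 // polyXsubC_eq0.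
(* As [u A + v B = 1], the product [G v B] is [G] modulo [A] and [0] modulo [B]; reducing modulo
   [A B] keeps both and bounds the degree. *)
pose q := (G * v * B) %/ (A * B); pose E := (G * v * B) %% (A * B).
have Eq : E = G * v * B - q * (A * B).
  by rewrite [in RHS](divp_eq (G * v * B) (A * B)) addrC addKr.
have AE : A %| E - G.
  rewrite (_ : E - G = A * (- (G * u) - q * B)) ?dvdp_mulr //.
  by rewrite Eq -[X in _ - X]mulr1 -uv; ring.
have BE : B %| E.
  by rewrite (_ : E = B * (G * v - q * A)) ?dvdp_mulr // Eq; ring.
have sE : (size E <= s + s)%N.
  rewrite -ltnS; have -> : (s + s).+1 = size (A * B).
    by rewrite size_mul // !size_exp_XsubC addnS.
  by rewrite ltn_modp mulf_neq0.
have AEc : A %| map_poly conjc E.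
  (* Conjugation exchanges [A] and [B], so this is the divisibility of [E] by [B]. *)
  rewrite -(@dvdp_map _ _ conjc) map_conjc_XsubC_exp.
  by rewrite (_ : map_poly _ (map_poly _ _) = E) //; apply/polyP => j;
     rewrite !coef_map /= conjcK.
exists (\poly_(j < s + s) (2 * complex.Re E`_j)); first exact: size_poly.
rewrite (_ : map_poly _ _ = E + map_poly conjc E).
  by rewrite addrAC dvdp_addl.
apply/polyP => j; rewrite coefD !coef_map coef_poly.
case: ltnP => jE.
  by case: E`_j => a b; apply/eqP; rewrite eq_complex /= subrr mulr_natl mulr2n !eqxx.
by rewrite nth_default ?(leq_trans sE) //= oppr0 addr0.
Qed.

Lemma dvdp_conj_fam k (eps : 'rV[R]_k) (z : R[i]) s :
  ('X - z%:P) ^+ s %| P_fam eps -> ('X - (conjc z)%:P) ^+ s %| P_fam eps.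
Proof.
by rewrite -map_conjc_XsubC_exp P_famE -[X in _ -> _ %| X]map_conjc_real dvdp_map.
Qed.

Lemma P_fam_neq0 k (eps : 'rV[R]_k) : P_fam eps != 0.
Proof. by rewrite P_famE map_poly_eq0 monic_neq0 ?monic_real_fam. Qed.

Lemma mup_nonreal_le k (eps : 'rV[R]_k) (z : R[i]) : z \isn't Num.real ->
  (mup z (P_fam eps) + mup z (P_fam eps) <= k.+1)%N.
Proof.
move=> zN; set s := mup z _; have P0 := P_fam_neq0 eps.
have dA : ('X - z%:P) ^+ s %| P_fam eps by rewrite -mup_geq.
have := dvdp_conj_fam dA; have := coprime_conj s zN => cop dB.
have /dvdp_leq -/(_ P0) : ('X - z%:P) ^+ s * ('X - (conjc z)%:P) ^+ s %| P_fam eps.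
  by rewrite Gauss_dvdp // dA.
rewrite size_mul ?expf_neq0 ?polyXsubC_eq0 // !size_exp_XsubC addnS /=.
by rewrite P_famE size_map_poly size_real_fam.
Qed.

Lemma coef_mulXn_lt (p : {poly R[i]}) s j : (j < s)%N -> ('X^s * p)`_j = 0.
Proof. by move=> js; rewrite coefXnM js. Qed.

(* Translating [z] by [c] changes [P] by [c P'] to first order: adding a
   multiple of [P'] kills the coefficient of [X^k], which the family lacks,
   at the cost of the coefficient of [X^(s-1)] only. *)
Lemma unfolding_surjective k (eps : 'rV[R]_k) (z : R[i])
    (Q v u : {poly R[i]}) (al : nat -> R[i]) :
  z \isn't Num.real ->
  let s := mup z (P_fam eps) in
  P_fam eps \Po ('X + z%:P) = 'X^s * Q -> v * Q = 1 + 'X^s * u ->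
  exists h : 'rV[R]_k, forall j, (j.+1 < s)%N ->
    (v * (map_poly (real_complex R) (\sum_(i < k) h 0 i *: 'X^i) \Po ('X + z%:P)))`_j
      = al j.
Proof.
move=> zN s PQ vQ.
(* The target [A] is multiplied by [Q] so that [v] will cancel it modulo [X^s], then moved back from
   [0] to [z]. *)
pose A := \poly_(j < s.-1) al j; pose G := (Q * A) \Po ('X - z%:P).
have [H sH /dvdpP[w Hw]] := real_interpolation s G zN.
have sk : (s + s <= k.+1)%N by exact: mup_nonreal_le.
clearbody s.
(* The derivative of the monic polynomial of degree [k + 1] has coefficient [k + 1] in degree
   [k]. *)
pose c := H`_k / k.+1%:R.
pose H' := H - c *: deriv (real_fam eps).
have sH' : (size H' <= k)%N.
  apply/leq_sizeP => j; rewrite leq_eqVlt => /predU1P[<-|kj].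
    rewrite coefB coefZ coef_deriv.
    have -> : (real_fam eps)`_k.+1 = 1.
      by have /monicP := monic_real_fam eps; rewrite lead_coefE size_real_fam.
    by rewrite divfK ?subrr // pnatr_eq0.
  rewrite nth_default // (leq_trans _ kj) // (leq_trans (size_polyD _ _)) //.
  rewrite geq_max (leq_trans sH sk) size_polyN (leq_trans (size_scale_leq _ _)) //.
  by rewrite (leq_trans (size_poly _ _)) // size_real_fam.
exists (\row_i H'`_i) => j js.
rewrite (_ : \sum_(i < k) _ = H'); last first.
  under eq_bigr do rewrite mxE.
  by rewrite -poly_def; apply/polyP => i; rewrite coef_poly; case: ltnP => // ki;
     rewrite nth_default // (leq_trans sH').
have PoK (p : {poly R[i]}) : (p \Po ('X - z%:P)) \Po ('X + z%:P) = p.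
  by rewrite -comp_polyA comp_polyB comp_polyX comp_polyC addrK comp_polyXr.
have HE : map_poly (real_complex R) H \Po ('X + z%:P) =
    Q * A + 'X^s * (w \Po ('X + z%:P)).
  have -> : map_poly (real_complex R) H = G + w * ('X - z%:P) ^+ s.
    by rewrite -Hw addrC subrK.
  rewrite comp_polyD PoK comp_polyM rmorphXn /= comp_polyB comp_polyX comp_polyC.
  by rewrite addrK [_ * 'X^s]mulrC.
(* Differentiating [X^s Q] leaves a factor [X^(s-1)], so the correction does not reach degrees below
   [s - 1]. *)
have DE : map_poly (real_complex R) (deriv (real_fam eps)) \Po ('X + z%:P) =
    'X^(s.-1) * (Q *+ s + 'X * deriv Q).
  rewrite -deriv_map -P_famE.
  have := congr1 (@deriv _) PQ; rewrite deriv_comp.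
  rewrite (_ : deriv ('X + z%:P) = 1) ?mulr1; last by rewrite derivD derivX derivC addr0.
  move=> ->; rewrite derivM derivXn.
  move: (deriv Q) => Q'.
  case: (s) js => // n _ /=.
  by rewrite exprSr -mulr_natl -[_ *+ n.+1 in RHS]mulr_natl; ring.
have -> : map_poly (real_complex R) H' \Po ('X + z%:P) =
    Q * A + 'X^s * (w \Po ('X + z%:P)) -
    (real_complex R c) *: ('X^(s.-1) * (Q *+ s + 'X * deriv Q)).
  by rewrite rmorphB /= comp_polyB HE map_polyZ /= comp_polyZ DE.
rewrite (_ : v * _ = A + 'X^s * (u * A + v * (w \Po ('X + z%:P)))
   - 'X^(s.-1) * ((real_complex R c) *: (v * (Q *+ s + 'X * deriv Q)))); last first.
  have rearrange (K : comPzRingType) (X Y A' u' v' w' d B : K) :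
    (1 + X * u') * A' + v' * (X * w') - v' * (d * (Y * B)) =
    A' + X * (u' * A' + v' * w') - Y * (d * (v' * B)) by ring.
  by rewrite mulrBr mulrDr mulrA vQ -!mul_polyC rearrange.
have js1 : (j < s.-1)%N by case: (s) js.
by rewrite coefB coefD !coef_mulXn_lt // ?subr0 ?addr0 ?coef_poly ?js1 // ltnW.
Qed.

End RealInterpolation.

(** * The unfolding map *)

Section Submersion.
Variables (R : realType) (k m : nat).

Lemma linear_rV_continuous (L : {linear 'rV[R]_k -> 'rV[R]_m}) : continuous L.
Proof.
have LE h : L h = \sum_(i < k) h 0 i *: L (delta_mx 0 i).
  by rewrite {1}(row_sum_delta h) raddf_sum; apply: eq_bigr => i _; rewrite /= linearZZ.
have -> : (L : _ -> _) = fun h => \sum_(i < k) h 0 i *: L (delta_mx 0 i).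
  exact/funext.
move=> x; have FF := nbhs_filter x.
apply: (cvg_big _ FF) => [|i _]; first exact: add_continuous.
by apply: cvgZ; [exact: coord_continuous | exact: cvg_cst].
Qed.

Lemma submersion_at_linear (V W : normedModType R) (f : V -> W)
    (L : {linear V -> W}) x : continuous L ->
  (forall e : R, 0 < e -> \forall t \near x,
    `|f t - f x - L (t - x)| <= e * `|t - x|) ->
  (forall y, exists h, L h = y) -> submersion_at f x.
Proof.
move=> Lc fL Lsurj.
have fE : f \o shift x = cst (f x) + L +o_ 0 id.
  apply/eqaddoP => e e0.
  have := fL e e0; rewrite (near_shift 0) subr0; apply: filterS => h /=.
  by rewrite addrK /cst /= opprD addrA.
have dL := diff_unique Lc fE.
split; first by apply/diff_locallyP; rewrite dL.
by rewrite dL => y _; have [h <-] := Lsurj y; exists h.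
Qed.

(** The norm on row vectors is the maximum norm, and finitely many entrywise estimates hold on a
    common neighbourhood. *)
Lemma submersion_at_rV (f : 'rV[R]_k -> 'rV[R]_m)
    (L : {linear 'rV[R]_k -> 'rV[R]_m}) x :
  (forall i (e : R), 0 < e -> \forall t \near x,
    `|f t 0 i - f x 0 i - L (t - x) 0 i| <= e * `|t - x|) ->
  (forall y, exists h, L h = y) -> submersion_at f x.
Proof.
move=> fL Lsurj; apply: submersion_at_linear Lsurj => [|e e0].
  exact: linear_rV_continuous.
have : \forall t \near x, forall i,
    `|f t 0 i - f x 0 i - L (t - x) 0 i| <= e * `|t - x|.
  have FF := nbhs_filter x.
  by apply: (@filter_forall _ _ (fun i t =>
    `|f t 0 i - f x 0 i - L (t - x) 0 i| <= e * `|t - x|) _ FF) => i; exact: fL.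
apply: filterS => h /= Hh.
rewrite [X in X <= _]/Num.norm /= mx_normrE.
apply/bigmax_leP; split; first by rewrite mulr_ge0 // ltW.
by move=> [i j] _ /=; rewrite ord1; have := Hh j; rewrite !mxE.
Qed.
End Submersion.

Lemma ler_normc_Re_Im (R : realType) (x : R[i]) (y : R) :
  `|x| <= real_complex R y -> `|complex.Re x| <= y /\ `|complex.Im x| <= y.
Proof.
rewrite normc_def lecR => xy; split; apply: le_trans xy;
  rewrite -sqrtr_sqr ler_wsqrtr // ?lerDl ?lerDr sqr_ge0 //.
Qed.

Lemma size_monic_sub_Xn (K : nzRingType) (p : {poly K}) n :
  p \is monic -> size p = n.+1 -> (size (p - 'X^n)%R <= n)%N.
Proof.
move=> /monicP pm sp; apply/leq_sizeP => j nj; rewrite coefB coefXn.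
have [->|jn] := eqVneq j n; first by rewrite -{1}[n]/(n.+1.-1) -sp -lead_coefE pm subrr.
by rewrite nth_default ?subr0 // sp ltn_neqAle eq_sym jn.
Qed.

(** * Local factorisation of the family at the singular point *)

Section Unfolding.
Variables (R : realType) (k : nat) (eps0 : 'rV[R]_k) (z0 : R[i]).
Let C : numClosedFieldType := R[i].
Let toC : R -> C := real_complex R.
Let rho (t : 'rV[R]_k) : C := toC `|t - eps0|.
Let F : set_system 'rV[R]_k := nbhs eps0.
Let FF : Filter F. Proof. exact: nbhs_filter. Qed.
Let s := mup z0 (P_fam eps0).
Let shiftP (p : {poly R[i]}) := p \Po ('X + z0%:P).
Let dP (h : 'rV[R]_k) := shiftP (map_poly toC (\sum_(i < k) h 0 i *: 'X^i)).

Lemma rho_ge0 t : 0 <= rho t.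
Proof. by rewrite ler0c. Qed.

(** The family is affine in its parameter, so the increment is exact and not merely first order. *)
Lemma shift_famE (t : 'rV[R]_k) :
  shiftP (P_fam t) = shiftP (P_fam eps0) + dP (t - eps0).
Proof.
rewrite -comp_polyD !P_famE -rmorphD; congr ((map_poly _ _) \Po _).
rewrite /real_fam -addrA -big_split; congr (_ + _); apply: eq_bigr => i _ /=.
by rewrite -scalerDl !mxE [eps0 0 i + _]addrC subrK.
Qed.

Lemma coef_dP h j : (dP h)`_j = \sum_(i < k) (('X + z0%:P) ^+ i)`_j * toC (h 0 i).
Proof.
rewrite /dP rmorph_sum /shiftP raddf_sum coef_sum; apply: eq_bigr => i _.
by rewrite /= map_polyZ map_polyXn /= comp_polyZ comp_Xn_poly coefZ mulrC.
Qed.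

Lemma Cgt0_real (e : R[i]) : 0 < e -> exists2 e' : R, 0 < e' & e = toC e'.
Proof.
case: e => a b; rewrite ltcE /= => /andP[/eqP b0 a0].
by exists a => //; apply/eqP; rewrite eq_complex /= eqxx b0 eqxx.
Qed.

Lemma entry_bigO (i : 'I_k) :
  is_bigO F rho (fun t => toC ((t - eps0) 0 i)).
Proof.
exists 1 => //; apply: nearW => t; rewrite mul1r normc_def /= expr0n addr0.
rewrite sqrtr_sqr lecR [leRHS]/Num.norm /= mx_normrE.
by apply/bigmax_geP; right; exists (0, i).
Qed.

Lemma rho_cvg0 : rho t @[t --> F] --> (0 : C).
Proof.
apply/cvgr0Pnorm_lt => _ /Cgt0_real[e e0 ->].
have : \forall t \near F, `|eps0 - t| < e by exact: cvgr_dist_lt.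
apply: filterS => t; rewrite ger0_norm ?rho_ge0 // ltcR.
by rewrite distrC.
Qed.

Lemma dP_bigO j : is_bigO F rho (fun t => (dP (t - eps0))`_j).
Proof.
rewrite (_ : (fun _ => _) = fun t =>
  \sum_(i < k) (('X + z0%:P) ^+ i)`_j * toC ((t - eps0) 0 i)).
  apply: bigO_sum => [|i _]; first exact: rho_ge0.
  by apply: cvgM_bigO (entry_bigO i); exact: cvg_cst.
by apply/funext => t; rewrite coef_dP.
Qed.

Lemma bigO_cvg0 (f : 'rV[R]_k -> C) :
  is_bigO F rho f -> f t @[t --> F] --> (0 : C).
Proof.
move=> [M M0 Mf]; apply/cvgr0Pnorm_lt => e e0.
have : \forall t \near F, `|rho t| < e / M.
  by apply: (@cvgr0_norm_lt _ _ _ _ _ _ rho_cvg0); rewrite divr_gt0.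
move: Mf; apply: filterS2 => t ft; rewrite ger0_norm ?rho_ge0 // => rt.
by rewrite (le_lt_trans ft) // mulrC -ltr_pdivlMr.
Qed.

Lemma shift_fam_cvg :
  poly_cvg F (fun t => shiftP (P_fam t)) (shiftP (P_fam eps0)).
Proof.
move=> j; rewrite -[X in _ --> X]addr0.
under eq_cvg do rewrite shift_famE coefD.
by apply: cvgD; [exact: cvg_cst | exact/bigO_cvg0/dP_bigO].
Qed.

Lemma zerosE (t : 'rV[R]_k) : P_fam t = \prod_(z <- zeros (P_fam t)) ('X - z%:P).
Proof.
rewrite {1}/zeros; case: closed_field_poly_normal => r /= {1}->.
have /monicP -> : P_fam t \is monic by rewrite P_famE map_monic monic_real_fam.
by rewrite scale1r.
Qed.

Lemma size_zeros (t : 'rV[R]_k) : size (zeros (P_fam t)) = k.+1.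
Proof.
apply: succn_inj; rewrite -(size_prod_XsubC (zeros (P_fam t)) id) -zerosE.
by rewrite P_famE size_map_poly size_real_fam.
Qed.

Lemma prod_shift (zs : seq R[i]) :
  shiftP (\prod_(z <- zs) ('X - z%:P)) = \prod_(z <- [seq z - z0 | z <- zs]) ('X - z%:P).
Proof.
rewrite big_map /shiftP (rmorph_prod (comp_poly _)); apply: eq_bigr => z _ /=.
by rewrite comp_polyB comp_polyX comp_polyC polyCB opprB addrA.
Qed.

(** The multiplicity counts the occurrences of [0] among the translated zeros; listing these first
    lets the two factors be products over index ranges. *)
Lemma shifted_zeros_split : exists l : seq R[i],
  [/\ perm_eq l [seq z - z0 | z <- zeros (P_fam eps0)],
      forall i, (i < s)%N -> l`_i = 0,
      forall i, (s <= i < k.+1)%N -> l`_i != 0, size l = k.+1 & (s <= k.+1)%N].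
Proof.
set zs := [seq _ | _ <- _]; have szs : size zs = k.+1 by rewrite size_map size_zeros.
have sE : s = count_mem 0 zs.
  rewrite /s {1}zerosE mu_prod_XsubC count_map; apply: eq_count => z /=.
  by rewrite subr_eq0.
pose l := [seq x <- zs | x == 0] ++ [seq x <- zs | x != 0].
have pl : perm_eq l zs by rewrite /l perm_filterC.
have sl : size l = k.+1 by rewrite (perm_size pl).
exists l; split=> // [i si|i /andP[si ik]|].
- rewrite nth_cat size_filter -sE si.
  have /allP := filter_all (fun x => x == 0) zs.
  by move=> /(_ (([seq x <- zs | x == 0])`_i)) /[!mem_nth] [/(_ isT)/eqP|];
     rewrite ?size_filter -?sE.
- rewrite nth_cat size_filter -sE ltnNge si /=.
  have /allP := filter_all (fun x => x != 0) zs; apply.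
  rewrite mem_nth // -(ltn_add2l s) subnKC //.
  by move: sl; rewrite size_cat size_filter -sE => ->.
- by rewrite -szs sE count_size.
Qed.


Lemma prod_shift_zeros (t : 'rV[R]_k) :
  shiftP (P_fam t) = \prod_(z <- [seq z - z0 | z <- zeros (P_fam t)]) ('X - z%:P).
Proof. by rewrite {1}zerosE prod_shift. Qed.

Lemma sorted_zeros : exists (l : seq C) (sig : 'rV[R]_k -> seq C),
  [/\ forall i, (i < s)%N -> l`_i = 0,
      forall i, (s <= i < k.+1)%N -> l`_i != 0,
      shiftP (P_fam eps0) = \prod_(0 <= i < k.+1) ('X - (l`_i)%:P),
      forall t, perm_eq (sig t) [seq z - z0 | z <- zeros (P_fam t)] &
      forall i, (sig t)`_i @[t --> F] --> (l`_i : C)].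
Proof.
have [l [pl l0 lN sl sk]] := shifted_zeros_split.
have lE : shiftP (P_fam eps0) = \prod_(z <- l) ('X - z%:P).
  by rewrite prod_shift_zeros; apply/esym/perm_big.
have [|||sig [ps cs]] := @roots_cvg C _ F _ k.+1
    (fun t => [seq z - z0 | z <- zeros (P_fam t)]) l.
- by move=> t; rewrite size_map size_zeros.
- by [].
- rewrite (_ : (fun _ => _) = fun t => shiftP (P_fam t)).
    by rewrite -lE; exact: shift_fam_cvg.
  by apply/funext => t; rewrite prod_shift_zeros.
- by exists l, sig; split=> //; rewrite lE (big_nth 0) sl.
Qed.

(** This replaces the selection by distance with a selection by index, in which [r] no longer
    occurs. *)
Lemma perm_zeros_near (r : R) (t : 'rV[R]_k) (sig : seq R[i]) :
  perm_eq sig [seq z - z0 | z <- zeros (P_fam t)] ->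
  (forall i, (i < s)%N -> `|sig`_i| < real_complex R r) ->
  (forall i, (s <= i < k.+1)%N -> real_complex R r < `|sig`_i|) ->
  perm_eq [seq z - z0 | z <- zeros_near (P_fam t) z0 r] (take s sig).
Proof.
move=> ps small large.
have ssig : size sig = k.+1 by rewrite (perm_size ps) size_map size_zeros.
rewrite /zeros_near -(filter_map _ (fun y => `|y| < real_complex R r)).
rewrite perm_sym -(permPr (perm_filter _ ps)) -{2}(cat_take_drop s sig) filter_cat.
have /all_filterP -> : all (fun y => `|y| < real_complex R r) (take s sig).
  apply/(all_nthP 0) => i; rewrite size_take_min leq_min => /andP[si _].
  by rewrite nth_take // small.
rewrite (_ : [seq y <- drop s sig | _] = [::]) ?cats0 //.
apply/eqP; rewrite -size_eq0 size_filter -leqn0 leqNgt -has_count.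
apply/(has_nthP 0) => -[n]; rewrite size_drop ssig => si; rewrite nth_drop.
apply/negP; rewrite -real_leNgt ?normr_real ?complex_real //.
by apply/ltW/large; rewrite leq_addr -ltn_subRL.
Qed.

Hypothesis root0 : root (P_fam eps0) z0.

Lemma mup_gt0 : (0 < s)%N.
Proof. by rewrite -XsubC_dvd ?P_fam_neq0 // dvdp_XsubCl. Qed.

(* [v] plays the role of [Q^-1], so the derivative of the unfolding map is
   [h |-> v * dP h], truncated below degree [s - 1]. *)
Lemma centered_weierstrass_expansion : exists (Q v u : {poly R[i]})
    (a : 'rV[R]_k -> {poly R[i]}),
  [/\ shiftP (P_fam eps0) = 'X^s * Q, v * Q = 1 + 'X^s * u,
      \forall r \near 0^'+, \forall t \near eps0,
        centered_weierstrass_poly (P_fam t) z0 r = a t &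
      forall j, (j.+1 < s)%N ->
        is_littleo F rho (fun t => (a t)`_j - (v * dP (t - eps0))`_j)].
Proof.
have [l [sig [l0 lN lE ps cs]]] := sorted_zeros.
have sk : (s <= k.+1)%N by have [? []] := shifted_zeros_split.
have ssig t : size (sig t) = k.+1 by rewrite (perm_size (ps t)) size_map size_zeros.
have s0 := mup_gt0; have pzn := perm_zeros_near.
clearbody s.
pose W t := \prod_(0 <= i < s) ('X - ((sig t)`_i)%:P).
pose Q t := \prod_(s <= i < k.+1) ('X - ((sig t)`_i)%:P).
pose Q0 := \prod_(s <= i < k.+1) ('X - (l`_i)%:P) : {poly C}.
have WQ t : W t * Q t = shiftP (P_fam t).
  rewrite prod_shift_zeros -(perm_big _ (ps t)) /= (big_nth 0) ssig.
  by rewrite (@big_cat_nat _ _ _ s).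
have Xs : \prod_(0 <= i < s) ('X - (l`_i)%:P) = 'X^s :> {poly C}.
  transitivity (\prod_(0 <= i < s) ('X : {poly C})).
    by apply: eq_big_nat => i /andP[_ si]; rewrite l0 // subr0.
  by rewrite prodr_const_nat subn0.
have PQ0 : shiftP (P_fam eps0) = 'X^s * Q0.
  by rewrite lE (@big_cat_nat _ _ _ s) //= Xs.
have Wcvg : poly_cvg F W 'X^s.
  rewrite -Xs.
  exact: (@poly_cvg_prod C _ F _ s (fun t i => (sig t)`_i) (nth 0 l) 0 cs).
have Qcvg : poly_cvg F Q Q0.
  exact: (@poly_cvg_prod C _ F _ k.+1 (fun t i => (sig t)`_i) (nth 0 l) s cs).
(* The roots of [Q0] are nonzero, so [Q0] is invertible modulo [X^s], with inverse [v]. *)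
have /Bezout_eq1_coprimepP[[u v] /= uv] : coprimep ('X^s) Q0.
  apply: coprimep_expl; rewrite -['X]subr0 coprimep_sym coprimep_XsubC.
  rewrite /root horner_prod prodf_seq_neq0; apply/allP => i.
  by rewrite mem_index_iota => /lN li /=; rewrite hornerXsubC sub0r oppr_eq0.
have vQ : v * Q0 = 1 + 'X^s * (- u) by rewrite -uv mulrN [u * _]mulrC addrAC subrr add0r.
pose D t := W t - 'X^s.
have sD t : (size (D t) <= s)%N.
  apply: size_monic_sub_Xn; first exact: monic_prod_XsubC.
  by rewrite size_prod_XsubC size_iota subn0.
have D_exp : forall j, (j < s)%N ->
    is_bigO F rho (fun t => (D t)`_j) /\
    is_littleo F rho (fun t => (D t)`_j - (v * dP (t - eps0))`_j).
  apply: (truncated_quotient_expansion rho_ge0 Qcvg) => [j js|t j js|j].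
  - by rewrite vQ coefD coef1 coef_mulXn_lt // addr0.
  (* Both [X^s Q0] and [X^s Q t] vanish below degree [s]; only the increment [dP] survives. *)
  - rewrite mulrBl WQ shift_famE PQ0 coefB coefD !coef_mulXn_lt //.
    by rewrite add0r subr0.
  - exact: dP_bigO.
have s1 : (s.-1 < s)%N by rewrite prednK.
(* By Vieta this is the mean of the zeros of [W t], as [X^s] has no term of degree [s - 1]. *)
pose b t : C := - (s%:R)^-1 * (D t)`_s.-1.
have bO : is_bigO F rho b.
  by apply: (@cvgM_bigO _ _ _ _ _ (fun=> - (s%:R)^-1 : C) _ (- (s%:R)^-1));
    [exact: cvg_cst | have [] := D_exp _ s1].
have b0 : b t @[t --> F] --> (0 : C) by exact: bigO_cvg0.
exists Q0, v, (- u), (fun t => ('X^s + D t) \Po ('X + (b t)%:P)).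
split=> //; last first.
  move=> j js; have js' := ltnW js.
  rewrite (_ : (fun _ => _) = fun t =>
    ((('X^s + D t) \Po ('X + (b t)%:P))`_j - (D t)`_j)
    + ((D t)`_j - (v * dP (t - eps0))`_j)); last first.
    by apply/funext => t; rewrite [RHS]addrA subrK.
  apply: littleoD; last by have [] := D_exp _ js'.
  by apply: (centered_coef_expansion rho_ge0) => // i si; have [] := D_exp _ si.
(* The radius is first taken below the moduli of the finitely many nonzero limit roots; [t] is then
   taken close to [eps0], depending on [r]. *)
have rl : \forall r \near 0^'+, forall i : 'I_k.+1, (s <= i)%N -> toC r < `|l`_i|.
  apply: filter_forall => i; have [si|_] := leqP s i; last exact: nearW.
  have : 0 < `|l`_i| by rewrite normr_gt0 lN // si ltn_ord.
  move=> /Cgt0_real[e e0 ->]; apply: filterS (nbhs_right_lt e0) => r re _.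
  by rewrite ltcR.
have rpos : \forall r \near (0 : R)^'+, 0 < r by exact: nbhs_right_gt.
move: rl rpos; apply: filterS2 => r rl r0.
have near_small : \forall t \near F, forall i : 'I_k.+1,
    if (i < s)%N then `|(sig t)`_i| < toC r else toC r < `|(sig t)`_i|.
  apply: filter_forall => i; case: ltnP => si.
    have ci := cs i; rewrite l0 // in ci.
    by apply: (@cvgr0_norm_lt _ _ _ _ _ _ ci); rewrite ltcR.
  by apply: (cvgr_norm_gt _ (cs i)); exact: rl.
move: near_small; apply: filterS => t Ht.
have small i : (i < s)%N -> `|(sig t)`_i| < toC r.
  by move=> si; have := Ht (Ordinal (leq_trans si sk)); rewrite /= si.
have large i : (s <= i < k.+1)%N -> toC r < `|(sig t)`_i|.
  by move=> /andP[si ik]; have := Ht (Ordinal ik); rewrite /= ltnNge si.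
have pz := pzn _ _ _ (ps t) small large.
set zn := zeros_near (P_fam t) z0 r in pz *.
have stake : size (take s (sig t)) = s by rewrite size_takel // ssig.
have szn : size zn = s by rewrite -stake -(perm_size pz) size_map.
have Wtake : W t = \prod_(y <- [seq z - z0 | z <- zn]) ('X - y%:P).
  rewrite (perm_big _ pz) /= (big_nth 0) stake.
  by apply: eq_big_nat => i /andP[_ si]; rewrite nth_take.
have bmean : b t = mean zn - z0.
  rewrite /b; have -> : (D t)`_s.-1 = - \sum_(y <- [seq z - z0 | z <- zn]) y.
    rewrite coefB coefXn ltn_eqF // subr0 Wtake.
    rewrite -[X in X.-1]szn -(size_map (fun z => z - z0) zn).
    by rewrite coefPn_prod_XsubC ?size_map ?szn -?lt0n.
  rewrite mulrNN big_map sumrB /mean szn big_const_seq count_predT szn iter_addr_0.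
  rewrite mulrBr mulrC -[z0 *+ s]mulr_natl mulKf // pnatr_eq0 -lt0n //.
(* Translations by [z0] and by [mean zn - z0] compose to the centering translation by [mean zn]. *)
rewrite /D ['X^s + _]addrC subrK Wtake bmean.
rewrite /centered_weierstrass_poly /weierstrass_poly -/zn.
rewrite big_map !(rmorph_prod (comp_poly _)); apply: eq_bigr => z _ /=.
rewrite !comp_polyB !comp_polyX !comp_polyC !polyCB opprB addrA.
by rewrite -['X + _ + z0%:P]addrA subrK.
Qed.

End Unfolding.

(** The layout is that of [unfolding_map], detached from the family so that real linearity can be
    used. *)
Definition real_coords (R : realType) n (p : {poly R[i]}) : 'rV[R]_(n + n) :=
  row_mx (\row_(j < n) complex.Re p`_j) (\row_(j < n) complex.Im p`_j).

Lemma real_coordsP (R : realType) n (p q : {poly R[i]}) :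
  real_coords n p = real_coords n q <-> forall j, (j < n)%N -> p`_j = q`_j.
Proof.
split=> [/eq_row_mx[/rowP Rpq /rowP Ipq] j jn|pq].
  have := Rpq (Ordinal jn); have := Ipq (Ordinal jn); rewrite !mxE /=.
  by case: p`_j => a b; case: q`_j => c d /= -> ->.
by congr row_mx; apply/rowP => j; rewrite !mxE pq.
Qed.

Lemma real_coords_linear (R : realType) n (c : R) (p q : {poly R[i]}) :
  real_coords n (real_complex R c *: p + q) =
  c *: real_coords n p + real_coords n q.
Proof.
rewrite /real_coords scale_row_mx add_row_mx; congr row_mx; apply/rowP => j;
  rewrite !mxE coefD coefZ; case: p`_j => a b; case: q`_j => a' b' /=;
  by rewrite mul0r ?subr0 ?addr0.
Qed.

Lemma real_coordsB (R : realType) n (p q : {poly R[i]}) :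
  real_coords n (p - q) = real_coords n p - real_coords n q.
Proof.
have := real_coords_linear n (-1) q p.
by rewrite rmorphN1 !scaleN1r addrC => ->; rewrite addrC.
Qed.

Lemma real_coords_le (R : realType) n (p : {poly R[i]}) (y : R) (i : 'I_(n + n)) :
  (forall j, (j < n)%N -> `|p`_j| <= real_complex R y) ->
  `|real_coords n p 0 i| <= y.
Proof.
move=> py; rewrite /real_coords; case: (split_ordP i) => j ->;
  by rewrite ?row_mxEl ?row_mxEr mxE; have [] := ler_normc_Re_Im (py j (ltn_ord j)).
Qed.

Theorem theorem5p1 (R : realType) (k : nat) (hk : (2 <= k)%N)
    (eps_star : 'rV[R]_k) (z0 : R[i]) (hz0 : z0 \isn't Num.real)
    (hroot : root (P_fam eps_star) z0) :
  full_unfolding eps_star z0.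
Proof.
have [Q [v [u [a [PQ vQ ra aO]]]]] := centered_weierstrass_expansion hroot.
rewrite /full_unfolding; set s := mup z0 _ in PQ vQ aO *.
have pred_s j : (j < s.-1)%N -> (j.+1 < s)%N by case: (s).
pose dP (h : 'rV[R]_k) :=
  map_poly (real_complex R) (\sum_(i < k) h 0 i *: 'X^i) \Po ('X + z0%:P).
have dP_linear (c : R) x y : dP (c *: x + y) = real_complex R c *: dP x + dP y.
  rewrite /dP -comp_polyZ -comp_polyD -map_polyZ -rmorphD; congr (map_poly _ _ \Po _).
  rewrite scaler_sumr -big_split; apply: eq_bigr => i _ /=.
  by rewrite !mxE scalerDl scalerA.
have dP0 : dP 0 = 0.
  by rewrite /dP big1 ?rmorph0 ?comp_poly0 // => i _; rewrite mxE scale0r.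
pose L h := real_coords s.-1 (v * dP h).
have L_linear : linear L.
  by move=> c x y; rewrite /L dP_linear mulrDr -scalerAr real_coords_linear.
pose LL : {linear 'rV[R]_k -> 'rV[R]_(s.-1 + s.-1)} :=
  HB.pack L (GRing.isLinear.Build _ _ _ _ L L_linear).
(* At [eps_star] itself the gauge is [0], so the little-o estimate becomes an equality. *)
have a0 j : (j < s.-1)%N -> (a eps_star)`_j = 0.
  move=> js; have js' := pred_s _ js.
  have /nbhs_singleton := aO j js' 1 ltr01.
  by rewrite subrr normr0 mulr0 normr_le0 -/(dP 0) dP0 mulr0 coef0 subr0 => /eqP.
(* The function [a] is the same for all small radii, so its estimates serve each of them. *)
move: ra; apply: filterS => r ra.
apply: (@submersion_at_rV _ _ _ _ LL) => [i e e0|y].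
  have fE t : centered_weierstrass_poly (P_fam t) z0 r = a t ->
      unfolding_map s z0 r t = real_coords s.-1 (a t) by move=> <-.
  have /fE fE0 := nbhs_singleton ra.
  have FF := nbhs_filter eps_star.
  pose close (j : 'I_s.-1) (t : 'rV[R]_k) :=
    `|(a t)`_j - (v * dP (t - eps_star))`_j|
      <= real_complex R e * real_complex R `|t - eps_star|.
  have near_le : \forall t \near eps_star, forall j, close j t.
    apply: (@filter_forall _ _ close _ FF).
    move=> j; apply: aO; last by rewrite ltcR.
    exact/pred_s/ltn_ord.
  move: ra near_le; apply: filterS2 => t /fE -> Ht.
  rewrite fE0 (_ : real_coords _ (a eps_star) = 0); last first.
    by rewrite -(subrr (real_coords s.-1 0)) -real_coordsB subrr;
       apply/real_coordsP => j js; rewrite a0 // coef0.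
  have -> : real_coords s.-1 (a t) 0 i - (0 : 'rV[R]_(s.-1 + s.-1)) 0 i
      - LL (t - eps_star) 0 i = real_coords s.-1 (a t - v * dP (t - eps_star)) 0 i.
    by rewrite real_coordsB /LL /= /L; move: (real_coords _ _) (real_coords _ _);
       move=> A B; rewrite !mxE subr0.
  apply: real_coords_le => j js.
  by rewrite coefB rmorphM; exact: (Ht (Ordinal js)).
(* The two halves of [y] are the real and imaginary parts of the targets; the default [0] is never
   read below [s - 1]. *)
pose al j : R[i] := if insub j is Some o
  then Complex (lsubmx y 0 o) (rsubmx y 0 o) else 0.
have [h Hh] := @unfolding_surjective _ _ _ _ Q v u al hz0 PQ vQ.
exists h; rewrite /LL /= -[RHS]hsubmxK /L /real_coords.
by congr row_mx; apply/rowP => j; rewrite mxE Hh /al ?valK //;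
  exact/pred_s/ltn_ord.
Qed.
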